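(* Suppose Assumption A (stated in the context) holds. Let $(x(t),v(t))$ be the solution on $[0,T]$ of the index-1 saddle dynamics with $x(0)=x_0$, $v(0)=v_0$, $\|v_0\|=1$, and let $\{x_n,v_n\}_{n=0}^{N_T}$ be generated by the explicit Euler scheme with step size $\tau=T/N_T$ described in the context. Define $e^x_n:=x(t_n)-x_n$ and $e^v_n:=v(t_n)-v_n$, where $t_n=n\tau$. Then there is a constant $Q>0$, depending on $L$, $T$, $\beta$ (and on the other fixed problem data $E$, $\gamma$, $x_0$, $v_0$) but independent of $\tau$, $n$ and $N_T$, such that $$\|e^x_{n}\|+\|e^v_{n}\|\leq Q\tau,\qquad 1\leq n\leq N_T.$$
   Context: $\|\cdot\|$ is the standard $l^2$ norm of a vector or the induced norm of a matrix, and $I$ is the $N\times N$ identity. $E:\mathbb R^N\to\mathbb R$ is twice Fréchet differentiable, $F(x)=-\nabla E(x)$ and $J(x)=-\nabla^2E(x)$ (so $J(x)=J(x)^\top$). $\beta,\gamma>0$ are fixed relaxation parameters and $T>0$ is a fixed terminal time. Assumption A: there is a constant $L>0$ such that for all $x,x_1,x_2\in\mathbb R^N$, $$\|J(x_2)-J(x_1)\|+\|F(x_2)-F(x_1)\|\leq L\|x_2-x_1\|,\qquad \|F(x)\|\leq L(1+\|x\|).$$ Index-1 saddle dynamics: $$\frac{dx}{dt}=\beta(I-2vv^\top)F(x),\qquad \frac{dv}{dt}=\gamma(I-vv^\top)J(x)v,$$ with initial conditions $x(0)=x_0$, $v(0)=v_0$, $\|v_0\|=1$. Explicit Euler scheme: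 for $N_T\in\mathbb N$, $\tau=T/N_T$, $t_n=n\tau$, starting from the given $x_0,v_0$, for $1\le n\le N_T$, $$x_n=x_{n-1}+\tau\beta(I-2v_{n-1}v_{n-1}^\top)F(x_{n-1}),$$ $$\tilde v_n=v_{n-1}+\tau\gamma(I-v_{n-1}v_{n-1}^\top)J(x_{n-1})v_{n-1},\qquad v_n=\frac{\tilde v_n}{\|\tilde v_n\|}.$$ *)

(* Defs.v *)
From HB Require Import structures.
From mathcomp Require Export all_boot all_order all_algebra.
From mathcomp Require Export all_classical all_reals all_analysis.

Set Implicit Arguments.
Unset Strict Implicit.
Unset Printing Implicit Defensive.

Export Order.TTheory GRing.Theory Num.Theory.
Export numFieldNormedType.Exports.

Local Open Scope classical_set_scope.
Local Open Scope ring_scope.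

(* The library's norm `|_| on matrices is the sup norm of the entries, hence
   the explicit Euclidean norm and its induced operator norm. *)
Definition l2norm (R : realType) (n : nat) (u : 'cV[R]_n) : R :=
  Num.sqrt (\sum_(i < n) u i 0 ^+ 2).

Definition opnorm (R : realType) (m n : nat) (A : 'M[R]_(m, n)) : R :=
  sup [set l2norm (A *m u) | u in [set u : 'cV[R]_n | l2norm u <= 1]].

Definition gradient (R : realType) (n : nat) (E : 'cV[R]_n -> R)
    (x : 'cV[R]_n) : 'cV[R]_n :=
  \col_(i < n) 'D_(delta_mx i 0) E x.

Definition hessian (R : realType) (n : nat) (E : 'cV[R]_n -> R)
    (x : 'cV[R]_n) : 'M[R]_n :=
  \matrix_(i < n, j < n) 'D_(delta_mx j 0) ('D_(delta_mx i 0) E) x.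

(* Differentiability of x |-> 'd E x is expressed through the gradient, which
   represents 'd E x in the standard basis. In the library, [differentiable] is
   Frechet differentiability; its use of the sup norm is immaterial, as all
   norms on R^n are equivalent. *)
Definition twice_differentiable (R : realType) (n : nat) (E : 'cV[R]_n -> R) :=
  (forall x, differentiable E x) /\ (forall x, differentiable (gradient E) x).

Section SaddleDynamics.
Variables (R : realType) (N : nat) (E : 'cV[R]_N -> R).

Definition force (x : 'cV[R]_N) : 'cV[R]_N := - gradient E x.
Definition negHessian (x : 'cV[R]_N) : 'M[R]_N := - hessian E x.

Definition assumptionA (L : R) : Prop :=
  (forall x1 x2 : 'cV[R]_N,
     opnorm (negHessian x2 - negHessian x1) + l2norm (force x2 - force x1)
       <= L * l2norm (x2 - x1)) /\
  (forall x : 'cV[R]_N, l2norm (force x) <= L * (1 + l2norm x)).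

Definition saddle_x (beta : R) (x v : 'cV[R]_N) : 'cV[R]_N :=
  beta *: ((1%:M - 2 *: (v *m v^T)) *m force x).

Definition saddle_v (gamma : R) (x v : 'cV[R]_N) : 'cV[R]_N :=
  gamma *: ((1%:M - v *m v^T) *m negHessian x *m v).

(* Solutions on [0, T] are continuous on [0, T] and satisfy the equations on
   ]0, T[; as the right-hand sides are continuous along such solutions, the
   equations then also hold at 0 and T with one-sided derivatives. *)
Definition saddle_solution (beta gamma T : R) (x0 v0 : 'cV[R]_N)
    (x v : R -> 'cV[R]_N) : Prop :=
  [/\ x 0 = x0, v 0 = v0,
      {within `[0, T], continuous x},
      {within `[0, T], continuous v} &
      forall t : R, 0 < t < T ->
        is_derive t 1 x (saddle_x beta (x t) (v t)) /\
        is_derive t 1 v (saddle_v gamma (x t) (v t))].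

Definition euler_step (beta gamma tau : R) (p : 'cV[R]_N * 'cV[R]_N) :
    'cV[R]_N * 'cV[R]_N :=
  let: (x, v) := p in
  let vtilde := v + tau *: saddle_v gamma x v in
  (x + tau *: saddle_x beta x v, (l2norm vtilde)^-1 *: vtilde).

Definition euler (beta gamma tau : R) (x0 v0 : 'cV[R]_N) (n : nat) :
    'cV[R]_N * 'cV[R]_N :=
  iter n (euler_step beta gamma tau) (x0, v0).

End SaddleDynamics.

(* Main.v *)
(* The Euler steps keep [v_n] on the unit sphere and the flow keeps [v t] there.
   Before normalization [v~_n] has norm at least 1, because its increment is
   orthogonal to [v_{n-1}]; as the radial projection onto the unit ball is
   nonexpansive, normalizing does not increase the distance to [v t_n]. Hence no
   bound on the numerical trajectory is needed: with [x t] confined to a ball by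
   Gronwall's inequality, both fields are Lipschitz between a point of the exact
   trajectory and any pair [(a, w)] with [w] a unit vector, the local truncation
   error is O(tau^2), and the discrete Gronwall inequality concludes. *)
Require Import Defs.
From mathcomp Require Import ring lra.

Set Implicit Arguments.
Unset Strict Implicit.
Unset Printing Implicit Defensive.

Local Open Scope classical_set_scope.
Local Open Scope ring_scope.

(** * Euclidean inner product and norm; reflections, projections and normalization *)

Definition dot (R : realType) (n : nat) (u v : 'cV[R]_n) : R :=
  \sum_(i < n) u i 0 * v i 0.

Section Euclidean.
Context {R : realType} {n : nat}.
Implicit Types (u v w : 'cV[R]_n) (a : R).

Lemma dotC u v : dot u v = dot v u.
Proof. by apply: eq_bigr => i _; rewrite mulrC. Qed.

Lemma dotDl u v w : dot (u + v) w = dot u w + dot v w.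
Proof. by rewrite -big_split; apply: eq_bigr => i _; rewrite mxE mulrDl. Qed.

Lemma dotZl a u v : dot (a *: u) v = a * dot u v.
Proof. by rewrite mulr_sumr; apply: eq_bigr => i _; rewrite mxE mulrA. Qed.

Lemma dotNl u v : dot (- u) v = - dot u v.
Proof. by rewrite -scaleN1r dotZl mulN1r. Qed.

Lemma dotBl u v w : dot (u - v) w = dot u w - dot v w.
Proof. by rewrite dotDl dotNl. Qed.

Lemma dotDr u v w : dot w (u + v) = dot w u + dot w v.
Proof. by rewrite !(dotC w) dotDl. Qed.

Lemma dotZr a u v : dot u (a *: v) = a * dot u v.
Proof. by rewrite !(dotC u) dotZl. Qed.

Lemma dotNr u v : dot u (- v) = - dot u v.
Proof. by rewrite !(dotC u) dotNl. Qed.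

Lemma dotBr u v w : dot w (u - v) = dot w u - dot w v.
Proof. by rewrite !(dotC w) dotBl. Qed.

Definition dotE := (dotDl, dotDr, dotBl, dotBr, dotNl, dotNr, dotZl, dotZr).

Lemma dotvv_ge0 u : 0 <= dot u u.
Proof. by apply: sumr_ge0 => i _; rewrite -expr2 sqr_ge0. Qed.

Lemma dot0r u : dot u 0 = 0.
Proof. by rewrite -(scale0r 0) dotZr mul0r. Qed.

Lemma dotvv_eq0 u : dot u u = 0 -> u = 0.
Proof.
move/eqP; rewrite psumr_eq0 => [/allP u0|i _]; last by rewrite -expr2 sqr_ge0.
apply/matrixP => i j; rewrite ord1 mxE.
by have := u0 i (mem_index_enum i); rewrite mulf_eq0 orbb => /eqP.
Qed.

Lemma l2normE u : l2norm u = Num.sqrt (dot u u).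
Proof. by congr Num.sqrt; apply: eq_bigr => i _; rewrite expr2. Qed.

Lemma sqr_l2norm u : l2norm u ^+ 2 = dot u u.
Proof. by rewrite l2normE sqr_sqrtr// dotvv_ge0. Qed.

Lemma l2norm_ge0 u : 0 <= l2norm u.
Proof. exact: sqrtr_ge0. Qed.

Lemma l2norm_le u a : 0 <= a -> (l2norm u <= a) = (dot u u <= a ^+ 2).
Proof. by move=> a0; rewrite -sqr_l2norm ler_sqr// nnegrE l2norm_ge0. Qed.

Lemma l2norm0 : l2norm (0 : 'cV[R]_n) = 0.
Proof. by rewrite l2normE dot0r sqrtr0. Qed.

Lemma l2normZ a u : l2norm (a *: u) = `|a| * l2norm u.
Proof.
by rewrite !l2normE !dotE mulrA sqrtrM -?expr2 ?sqr_ge0// sqrtr_sqr.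
Qed.

Lemma l2normN u : l2norm (- u) = l2norm u.
Proof. by rewrite -scaleN1r l2normZ normrN1 mul1r. Qed.

(** Cauchy-Schwarz: the squared norm of [u - a *: v] is nonnegative for every [a], in particular at
    its minimizer [a = dot u v / dot v v]. The case [v = 0] is treated apart. *)
Lemma sqr_dot_le u v : dot u v ^+ 2 <= dot u u * dot v v.
Proof.
have q a : 0 <= dot u u - 2 * a * dot u v + a ^+ 2 * dot v v.
  have := dotvv_ge0 (u - a *: v).
  by rewrite !dotE (dotC v u); lra.
have := dotvv_ge0 v; rewrite le_eqVlt => /predU1P[v0|v0].
  by rewrite (dotvv_eq0 (esym v0)) !dot0r expr0n mulr0.
have := q (dot u v / dot v v).
suff -> : dot u u - 2 * (dot u v / dot v v) * dot u v
    + (dot u v / dot v v) ^+ 2 * dot v v =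
    (dot u u * dot v v - dot u v ^+ 2) / dot v v.
  by rewrite pmulr_lge0 ?invr_gt0// subr_ge0.
by field; rewrite gt_eqF.
Qed.

Lemma normr_dot_le u v : `|dot u v| <= l2norm u * l2norm v.
Proof.
rewrite -(@ler_pXn2r _ 2)// ?nnegrE ?mulr_ge0 ?l2norm_ge0//.
by rewrite exprMn !sqr_l2norm real_normK ?num_real// sqr_dot_le.
Qed.

Lemma dot_le u v : dot u v <= l2norm u * l2norm v.
Proof. exact: le_trans (ler_norm _) (normr_dot_le u v). Qed.

Lemma l2normD u v : l2norm (u + v) <= l2norm u + l2norm v.
Proof.
rewrite l2norm_le ?addr_ge0 ?l2norm_ge0// !dotE (dotC v u) sqrrD !sqr_l2norm.
by have := dot_le u v; lra.
Qed.

Lemma l2normBD u v w : l2norm (u - w) <= l2norm (u - v) + l2norm (v - w).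
Proof. by have := l2normD (u - v) (v - w); rewrite addrA subrK. Qed.

Lemma outer_mulmx v w : v *m v^T *m w = dot v w *: v.
Proof.
apply/matrixP => i j; rewrite [j]ord1 -mulmxA !mxE big_ord1 mulrC.
by rewrite mxE; congr (_ * _); apply: eq_bigr => k _; rewrite !mxE.
Qed.

Lemma l2norm_reflection v w : l2norm v = 1 ->
  l2norm (w - (2 * dot v w) *: v) = l2norm w.
Proof.
move=> v1; rewrite !l2normE !dotE -(sqr_l2norm v) v1 (dotC w v).
by congr Num.sqrt; ring.
Qed.

Lemma l2norm_projection v w : l2norm v = 1 ->
  l2norm (w - dot v w *: v) <= l2norm w.
Proof.
move=> v1; rewrite l2norm_le ?l2norm_ge0// !dotE -!sqr_l2norm v1 (dotC w v).
by have := sqr_ge0 (dot v w); lra.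
Qed.

(** The direction occurs twice in [dot u w *: u]; replacing [u] by [v] one occurrence at a time
    costs [l2norm (u - v) * l2norm w] each, whence the factor 2. *)
Lemma l2norm_outerB u v w : l2norm u = 1 -> l2norm v = 1 ->
  l2norm (dot u w *: u - dot v w *: v) <= 2 * l2norm (u - v) * l2norm w.
Proof.
move=> u1 v1.
have -> : dot u w *: u - dot v w *: v = dot (u - v) w *: u + dot v w *: (u - v).
  by rewrite dotBl scalerBl scalerBr addrA subrK.
apply: le_trans (l2normD _ _) _; rewrite !l2normZ u1 mulr1.
have := normr_dot_le (u - v) w; have := normr_dot_le v w; rewrite v1.
have := l2norm_ge0 (u - v); nra.
Qed.

(** With [s = l2norm w] and [d = dot u w <= s], the two squared distances differ by
    [s ^+ 2 - 1 - 2 * (1 - s^-1) * d]. As [s^-1 <= 1], replacing [d] by [s] bounds this below by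
    [(s - 1) ^+ 2]. *)
Lemma l2norm_normalize u w : l2norm u = 1 -> 1 <= l2norm w ->
  l2norm (u - (l2norm w)^-1 *: w) <= l2norm (u - w).
Proof.
move=> u1 w1; rewrite l2norm_le ?l2norm_ge0// sqr_l2norm !dotE.
rewrite -(sqr_l2norm u) -(sqr_l2norm w) u1 (dotC w u).
have := dot_le u w; rewrite u1 mul1r.
set s := l2norm w in w1 *; have s0 : 0 < s by rewrite (lt_le_trans _ w1).
have : s^-1 <= 1 by rewrite invf_le1.
have : s^-1 * s = 1 by rewrite mulVf ?gt_eqF.
move: s^-1 (dot u w) => r d rs r1 ds.
have -> : r * (r * s ^+ 2) = 1 by rewrite expr2 (mulrA r s) rs mul1r.
have : (1 - r) * d <= (1 - r) * s by apply: ler_wpM2l => //; lra.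
by have := sqr_ge0 (s - 1); lra.
Qed.

Lemma l2norm_normalized w : 1 <= l2norm w -> l2norm ((l2norm w)^-1 *: w) = 1.
Proof.
move=> w1; have w0 : 0 < l2norm w by rewrite (lt_le_trans _ w1).
by rewrite l2normZ gtr0_norm ?invr_gt0// mulVf ?gt_eqF.
Qed.

End Euclidean.

(** * The induced operator norm *)

Section OperatorNorm.
Context {R : realType} {m n : nat}.
Implicit Types (A : 'M[R]_(m, n)) (u : 'cV[R]_n).

(** Needed for the [sup] in [opnorm] to be a genuine upper bound. Cauchy-Schwarz on each row gives
    the Frobenius norm of [A] as a bound. *)
Lemma opnorm_has_ubound A :
  has_ubound [set l2norm (A *m u) | u in [set u : 'cV[R]_n | l2norm u <= 1]].
Proof.
exists (Num.sqrt (\sum_(i < m) dot (row i A)^T (row i A)^T)) => _ [u u1 <-].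
rewrite ler_sqrt; last by apply: sumr_ge0 => i _; exact: dotvv_ge0.
apply: ler_sum => i _.
have -> : (A *m u) i 0 = dot (row i A)^T u.
  by rewrite mxE; apply: eq_bigr => k _; rewrite !mxE.
apply: le_trans (sqr_dot_le _ _) _; rewrite ler_piMr ?dotvv_ge0//.
by rewrite -(expr1n R 2) -l2norm_le.
Qed.

Lemma le_opnorm A u : l2norm u <= 1 -> l2norm (A *m u) <= opnorm A.
Proof.
by move=> u1; apply: ub_le_sup; [exact: opnorm_has_ubound|exists u].
Qed.

Lemma opnorm_ge0 A : 0 <= opnorm A.
Proof.
apply: le_trans (l2norm_ge0 (A *m 0)) _; apply: le_opnorm.
by rewrite l2norm0.
Qed.

Lemma l2norm_mulmx A u : l2norm (A *m u) <= opnorm A * l2norm u.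
Proof.
have := l2norm_ge0 u; rewrite le_eqVlt => /predU1P[u0|u0].
  have -> : u = 0 by apply: dotvv_eq0; rewrite -sqr_l2norm -u0 expr0n.
  by rewrite mulmx0 !l2norm0 mulr0.
rewrite -ler_pdivrMr// mulrC -(ger0_norm (ltW u0)) -normfV -l2normZ scalemxAr.
apply: le_opnorm; rewrite l2normZ gtr0_norm ?invr_gt0//.
by rewrite mulVf ?gt_eqF.
Qed.

End OperatorNorm.

(** * Perturbation of reflections and projections *)

(** Separates two effects: the argument moves from [p] to [q] with the direction [w] fixed, then the
    direction moves from [v] to [w] with the argument [p] fixed. The values [k = 2] and [k = 1] give
    the reflection and the projection. *)
Lemma rank1_updateB (R : realType) (n : nat) (k : R) (p q v w : 'cV[R]_n) :
  p - (k * dot v p) *: v - (q - (k * dot w q) *: w) =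
  (p - q - (k * dot w (p - q)) *: w) - k *: (dot v p *: v - dot w p *: w).
Proof.
apply/matrixP => i j; rewrite dotBr !mxE.
by move: (dot v p) (dot w p) (dot w q) => x y z; ring.
Qed.

(** The bound is deliberately asymmetric: only the size of [p] enters, so [q] may later come from a
    numerical point without any bound on it. *)
Lemma l2norm_reflectionB (R : realType) (n : nat) (p q v w : 'cV[R]_n) :
  l2norm v = 1 -> l2norm w = 1 ->
  l2norm (p - (2 * dot v p) *: v - (q - (2 * dot w q) *: w)) <=
  l2norm (p - q) + 4 * l2norm p * l2norm (v - w).
Proof.
move=> v1 w1; rewrite rank1_updateB; apply: le_trans (l2normD _ _) _.
rewrite l2norm_reflection// lerD2l l2normN l2normZ ger0_norm//.
apply: le_trans (ler_wpM2l _ (l2norm_outerB p v1 w1)) _ => //.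
by rewrite le_eqVlt; apply/orP; left; apply/eqP; ring.
Qed.

Lemma l2norm_projectionB (R : realType) (n : nat) (p q v w : 'cV[R]_n) :
  l2norm v = 1 -> l2norm w = 1 ->
  l2norm (p - dot v p *: v - (q - dot w q *: w)) <=
  l2norm (p - q) + 2 * l2norm p * l2norm (v - w).
Proof.
move=> v1 w1; have := rank1_updateB 1 p q v w; rewrite !mul1r scale1r => ->.
apply: le_trans (l2normD _ _) _; rewrite l2normN mulrAC.
by apply: lerD; [exact: l2norm_projection|exact: l2norm_outerB].
Qed.

Lemma mulmx_subM (R : realType) (m n : nat) (A B : 'M[R]_(m, n)) v w :
  A *m v - B *m w = (A - B) *m w + A *m (v - w) :> 'cV[R]_m.
Proof. by rewrite mulmxBl mulmxBr [RHS]addrC addrA subrK. Qed.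

(** * Bounds and one-sided Lipschitz estimates for the two vector fields *)

Section SaddleFields.
Context {R : realType} {N : nat} {E : 'cV[R]_N -> R}.
Implicit Types (a b u v w : 'cV[R]_N).

Lemma saddle_xE beta a v : saddle_x E beta a v =
  beta *: (force E a - (2 * dot v (force E a)) *: v).
Proof.
by rewrite /saddle_x mulmxBl mul1mx -scalemxAl outer_mulmx scalerA.
Qed.

Lemma saddle_vE gamma a v : saddle_v E gamma a v =
  gamma *: (negHessian E a *m v - dot v (negHessian E a *m v) *: v).
Proof. by rewrite /saddle_v -mulmxA mulmxBl mul1mx outer_mulmx. Qed.

(** The factor [1 - dot v v] serves twice: it makes the Euler increment orthogonal to a unit vector,
    and it makes the defect from unit length obey a linear equation along the flow. *)
Lemma dot_saddle_v gamma a v : dot v (saddle_v E gamma a v) =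
  gamma * dot v (negHessian E a *m v) * (1 - dot v v).
Proof. by rewrite saddle_vE !dotE; ring. Qed.

(* The increment is orthogonal to the unit vector [w]. *)
Lemma l2norm_euler_v_ge1 gamma h a w : l2norm w = 1 ->
  1 <= l2norm (w + h *: saddle_v E gamma a w).
Proof.
move=> w1; have : dot w (saddle_v E gamma a w) = 0.
  by rewrite dot_saddle_v -sqr_l2norm w1 expr1n subrr mulr0.
move: (saddle_v E gamma a w) => S wS.
rewrite -(@ler_pXn2r _ 2)// ?nnegrE ?l2norm_ge0// expr1n sqr_l2norm !dotE.
rewrite (dotC S w) wS -(sqr_l2norm w) w1 expr1n mulr0 add0r addr0 lerDl.
by rewrite mulrA mulr_ge0 ?dotvv_ge0// -expr2 sqr_ge0.
Qed.

Variable L : R.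
Hypothesis hA : assumptionA E L.

Lemma force_lip a b : l2norm (force E a - force E b) <= L * l2norm (a - b).
Proof.
apply: le_trans (hA.1 b a); rewrite lerDr; exact: opnorm_ge0.
Qed.

Lemma force_growth a : l2norm (force E a) <= L * (1 + l2norm a).
Proof. exact: hA.2. Qed.

Lemma negHessian_lip a b u :
  l2norm ((negHessian E a - negHessian E b) *m u)
    <= L * l2norm (a - b) * l2norm u.
Proof.
apply: le_trans (l2norm_mulmx _ _) _; apply: ler_wpM2r; first exact: l2norm_ge0.
by apply: le_trans (hA.1 b a); rewrite lerDl; exact: l2norm_ge0.
Qed.

(** Lipschitz continuity turns the operator norm at a reference point [b] into a bound at [a]; [b]
    will be the initial position. *)
Lemma negHessian_growth a b u : l2norm (negHessian E a *m u) <=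
  (opnorm (negHessian E b) + L * l2norm (a - b)) * l2norm u.
Proof.
have -> : negHessian E a = negHessian E b + (negHessian E a - negHessian E b).
  by rewrite addrC subrK.
rewrite mulmxDl mulrDl; apply: le_trans (l2normD _ _) _.
by apply: lerD; [exact: l2norm_mulmx|exact: negHessian_lip].
Qed.

Section Bounds.
Variables (beta gamma : R).
Hypotheses (beta0 : 0 <= beta) (gamma0 : 0 <= gamma).

Lemma l2norm_saddle_x a v : l2norm v = 1 ->
  l2norm (saddle_x E beta a v) <= beta * (L * (1 + l2norm a)).
Proof.
move=> v1; rewrite saddle_xE l2normZ ger0_norm// l2norm_reflection//.
exact: ler_wpM2l (force_growth a).
Qed.

(** The growth bound is applied at [a] alone. In the error estimate [a] lies on the exact trajectory
    and [b] is arbitrary. *)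
Lemma saddle_x_lip a b v w : l2norm v = 1 -> l2norm w = 1 ->
  l2norm (saddle_x E beta a v - saddle_x E beta b w) <=
  beta * (L * l2norm (a - b) + 4 * (L * (1 + l2norm a)) * l2norm (v - w)).
Proof.
move=> v1 w1; rewrite !saddle_xE -scalerBr l2normZ ger0_norm//.
apply: ler_wpM2l => //.
apply: le_trans (l2norm_reflectionB _ _ v1 w1) _.
apply: lerD; first exact: force_lip.
apply: ler_wpM2r; first exact: l2norm_ge0.
by apply: ler_wpM2l => //; exact: force_growth.
Qed.

Lemma l2norm_saddle_v a v M :
  (forall u, l2norm (negHessian E a *m u) <= M * l2norm u) -> l2norm v = 1 ->
  l2norm (saddle_v E gamma a v) <= gamma * M.
Proof.
move=> aM v1; rewrite saddle_vE l2normZ ger0_norm//; apply: ler_wpM2l => //.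
by apply: le_trans (l2norm_projection _ v1) _; have := aM v; rewrite v1 mulr1.
Qed.

(** In [3 * M], one [M] comes from moving the vector to which the matrix at [a] is applied, and two
    come from moving the direction of the projection. *)
Lemma saddle_v_lip a b v w M :
  (forall u, l2norm (negHessian E a *m u) <= M * l2norm u) ->
  l2norm v = 1 -> l2norm w = 1 ->
  l2norm (saddle_v E gamma a v - saddle_v E gamma b w) <=
  gamma * (L * l2norm (a - b) + 3 * M * l2norm (v - w)).
Proof.
move=> aM v1 w1; rewrite !saddle_vE -scalerBr l2normZ ger0_norm//.
apply: ler_wpM2l => //.
apply: le_trans (l2norm_projectionB _ _ v1 w1) _.
rewrite mulmx_subM.
have JB : l2norm ((negHessian E a - negHessian E b) *m w) <=
    L * l2norm (a - b).
  by have := negHessian_lip a b w; rewrite w1 mulr1.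
have Jv : l2norm (negHessian E a *m v) <= M by have := aM v; rewrite v1 mulr1.
have -> : 3 * M * l2norm (v - w) = M * l2norm (v - w) + 2 * M * l2norm (v - w).
  by move: (l2norm (v - w)) => d; ring.
rewrite addrA; apply: lerD.
  exact: le_trans (l2normD _ _) (lerD JB (aM (v - w))).
by apply: ler_wpM2r; [exact: l2norm_ge0|exact: ler_wpM2l].
Qed.

End Bounds.
End SaddleFields.

(** * Vector calculus on an interval and the two Gronwall inequalities *)

Section Calculus.
Context {R : realType} {n : nat}.
Implicit Types (f g : R -> 'cV[R]_n) (df dg : 'cV[R]_n).

Lemma is_derive_coord f df (t : R) i :
  is_derive t 1 f df -> is_derive t 1 (fun s => f s i 0) (df i 0).
Proof.
move=> fdf; apply: DeriveDef; first exact: (derivable_mxP _ _ _).1.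
have := @derive_val _ _ _ _ _ _ _ fdf.
by rewrite derive_mx// => <-; rewrite mxE.
Qed.

(** Puts the inner product in the form of a finite sum of products of functions, to which the sum
    and product rules apply. *)
Lemma dot_fctE f g : (fun s => dot (f s) (g s)) =
  \sum_(i < n) ((fun s => f s i 0) * (fun s => g s i 0)).
Proof. by apply/funext => s; rewrite fct_sumE. Qed.

Lemma is_derive_dot f g df dg (t : R) :
  is_derive t 1 f df -> is_derive t 1 g dg ->
  is_derive t 1 (fun s => dot (f s) (g s)) (dot df (g t) + dot (f t) dg).
Proof.
move=> fdf gdg; rewrite dot_fctE.
have -> : dot df (g t) + dot (f t) dg =
    \sum_(i < n) (f t i 0 *: dg i 0 + g t i 0 *: df i 0).
  rewrite addrC -big_split; apply: eq_bigr => i _ /=.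
  by congr (_ + _); rewrite mulrC.
apply: is_derive_sum => i.
by apply: is_deriveM; exact: is_derive_coord.
Qed.

Lemma within_continuous_coord (A : set R) f i :
  {within A, continuous f} -> {within A, continuous (fun s => f s i 0)}.
Proof.
apply: (@within_continuous_comp _ _ _ A f (fun z : 'cV[R]_n => z i 0)).
by move=> z _; exact: coord_continuous.
Qed.

Lemma within_continuous_dot (A : set R) f g :
  {within A, continuous f} -> {within A, continuous g} ->
  {within A, continuous (fun s => dot (f s) (g s))}.
Proof.
move=> cf cg; rewrite dot_fctE.
apply: (@big_ind _ (fun h : R -> R => {within A, continuous h})).
- by move=> t; exact: cvg_cst.
- by move=> h k ch ck; exact: within_continuousD.
- move=> i _ t; apply: cvgM; exact: within_continuous_coord.
Qed.

Lemma within_continuous_l2norm_bounded f (a b : R) : a <= b ->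
  {within `[a, b], continuous f} ->
  exists2 K, 0 <= K & forall t, t \in `[a, b] -> l2norm (f t) <= K.
Proof.
move=> ab cf.
have [c _ fc] := EVT_max ab (within_continuous_dot cf cf).
exists (l2norm (f c)) => [|t tab]; first exact: l2norm_ge0.
by rewrite l2norm_le ?l2norm_ge0// sqr_l2norm; exact: fc.
Qed.

(** The scalar mean value theorem is applied to [dot w (f s)] with [w = f b - f a]; Cauchy-Schwarz
    and division by [l2norm w] then give the vector bound. *)
Lemma l2norm_mean_value f (df : R -> 'cV[R]_n) (a b K : R) : a <= b ->
  {within `[a, b], continuous f} ->
  (forall t, t \in `]a, b[ -> is_derive t 1 f (df t)) ->
  (forall t, t \in `]a, b[ -> l2norm (df t) <= K) ->
  l2norm (f b - f a) <= K * (b - a).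
Proof.
rewrite le_eqVlt => /predU1P[-> _ _ _|ab cf fdf dfK].
  by rewrite !subrr mulr0 l2norm0.
set w := f b - f a.
have cw : {within `[a, b], continuous (fun=> w)} by move=> t; exact: cvg_cst.
have [|c cab] := @MVT R (fun s => dot w (f s)) (fun s => dot w (df s)) a b ab _
  (within_continuous_dot cw cf).
  move=> t tab; have := is_derive_dot (is_derive_cst w t 1) (fdf _ tab).
  by rewrite dotC dot0r add0r.
rewrite -dotBr -/w -sqr_l2norm => ww.
(* If [w = 0] the claim needs [0 <= K], which the bound on [df] at the intermediate point [c]
   provides. *)
have := l2norm_ge0 w; rewrite le_eqVlt => /predU1P[<-|w0].
  by rewrite mulr_ge0 ?subr_ge0 ?(ltW ab)//
    (le_trans (l2norm_ge0 _) (dfK c cab)).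
rewrite -(ler_pM2l w0) -expr2 ww mulrA ler_pM2r ?subr_gt0//.
apply: le_trans (dot_le _ _) _.
by rewrite ler_pM2l// dfK.
Qed.

(** This is the mean value bound for [f s - s *: p], whose derivative is [df s - p]. *)
Lemma l2norm_taylor1 f (df : R -> 'cV[R]_n) p (a b K : R) : a <= b ->
  {within `[a, b], continuous f} ->
  (forall t, t \in `]a, b[ -> is_derive t 1 f (df t)) ->
  (forall t, t \in `]a, b[ -> l2norm (df t - p) <= K) ->
  l2norm (f b - (f a + (b - a) *: p)) <= K * (b - a).
Proof.
move=> ab cf fdf dfK.
have -> : f b - (f a + (b - a) *: p) = (f b - b *: p) - (f a - a *: p).
  by apply/matrixP => i j; rewrite !mxE; ring.
apply: (@l2norm_mean_value (fun s => f s - s *: p) (fun s => df s - p)) => //.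
  move=> s; apply: cvgB; first exact: cf.
  by apply: continuous_subspaceT => r; exact: scalel_continuous.
move=> t /fdf fdft; apply: is_deriveB.
apply: DeriveDef.
  by apply: diff_derivable; exact: ex_diff.
by rewrite deriveE ?diff_val// ?scale1r//; exact: ex_diff.
Qed.

(** The product [phi s * expR (- K * s)] has a nonpositive derivative, so it does not exceed its
    value at 0. *)
Lemma gronwall (phi dphi : R -> R) (K T : R) :
  {within `[0, T], continuous phi} ->
  (forall t, t \in `]0, T[ -> is_derive t 1 phi (dphi t)) ->
  (forall t, t \in `]0, T[ -> dphi t <= K * phi t) ->
  forall t, t \in `[0, T] -> phi t <= phi 0 * expR (K * t).
Proof.
move=> cphi phid le_dphi t; rewrite in_itv/= => /andP[t0 tT].
pose psi s := phi s * expR (- K * s).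
pose dpsi s := phi s *: (expR (- K * s) *: (- K)) + expR (- K * s) *: dphi s.
have psid s : s \in `]0, t[ -> is_derive s 1 psi (dpsi s).
  move=> s0t; apply: is_deriveM.
    by apply: phid; move: s0t; rewrite !in_itv/= => /andP[-> /lt_le_trans->].
  apply: is_derive1_comp.
  have := @is_deriveZ _ _ _ id (- K) s 1 1 (is_derive_id _ _).
  by rewrite /GRing.scale/= mulr1.
have psic : {within `[0, t], continuous psi}.
  move=> s; apply: cvgM.
    apply: continuous_subspaceW cphi _.
    by apply: subset_itvl; rewrite bnd_simp.
  apply: continuous_subspaceT => r.
  apply: continuous_comp; last exact: continuous_expR.
  exact: mulrl_continuous.
have : psi t <= psi 0.
  move: t0; rewrite le_eqVlt => /predU1P[->//|t0].
  have [c c0t psi0t] := MVT t0 psid psic.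
  rewrite -subr_le0 psi0t subr0 pmulr_lle0// /dpsi /GRing.scale/=.
  have -> : phi c * (expR (- K * c) * - K) + expR (- K * c) * dphi c =
      expR (- K * c) * (dphi c - K * phi c) by ring.
  rewrite pmulr_rle0 ?expR_gt0// subr_le0 le_dphi//.
  by move: c0t; rewrite !in_itv/= => /andP[-> /lt_le_trans->].
rewrite /psi mulr0 expR0 mulr1 mulNr expRN.
by rewrite ler_pdivrMr ?expR_gt0.
Qed.

(** Induction: [1 + a <= expR a] absorbs the amplification of one step, and the new term [b] is
    absorbed because the exponential is at least 1. *)
Lemma discrete_gronwall (e : nat -> R) (a b : R) (m : nat) :
  0 <= a -> 0 <= b -> e 0 <= 0 ->
  (forall k, (k < m)%N -> e k.+1 <= (1 + a) * e k + b) ->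
  forall k, (k <= m)%N -> e k <= k%:R * b * expR (k%:R * a).
Proof.
move=> a0 b0 e0 eS; elim=> [_|k IH km]; first by rewrite !mul0r.
apply: le_trans (eS k km) _.
have expS : expR (k.+1%:R * a) = expR a * expR (k%:R * a).
  by rewrite -natr1 mulrDl mul1r addrC expRD.
have exp_ge1 : 1 <= expR (k.+1%:R * a) by rewrite -expR0 ler_expR mulr_ge0.
have -> : k.+1%:R * b * expR (k.+1%:R * a) =
    expR a * (k%:R * b * expR (k%:R * a)) + b * expR (k.+1%:R * a).
  by rewrite expS -natr1; ring.
apply: lerD; last by rewrite ler_peMr.
apply: le_trans (ler_wpM2l _ (IH (ltnW km))) _; first by rewrite addr_ge0.
by apply: ler_wpM2r; [rewrite !mulr_ge0// expR_ge0|exact: expR_ge1Dx].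
Qed.

End Calculus.

(** * A priori properties of the exact solution *)

Section Solution.
Context {R : realType} {N : nat} {E : 'cV[R]_N -> R}.
Context {beta gamma T L : R} {x0 v0 : 'cV[R]_N} {x v : R -> 'cV[R]_N}.
Hypotheses (beta_ge0 : 0 <= beta) (gamma_ge0 : 0 <= gamma) (T_ge0 : 0 <= T).
Hypotheses (L_ge0 : 0 <= L) (hA : assumptionA E L) (v0_unit : l2norm v0 = 1).
Hypothesis sol : saddle_solution E beta gamma T x0 v0 x v.

Lemma solution_unit t : t \in `[0, T] -> l2norm (v t) = 1.
Proof.
case: sol => _ v00 cx cv ode.
(* Compactness of the time interval supplies the bounds here; the explicit bound of
   [solution_bounded] rests on the present lemma. *)
have [Kv Kv0 vK] := within_continuous_l2norm_bounded T_ge0 cv.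
have cx0 : {within `[0, T], continuous (fun s => x s - x0)}.
  by move=> s; apply: cvgB; [exact: cx|exact: cvg_cst].
have [Kx Kx0 xK] := within_continuous_l2norm_bounded T_ge0 cx0.
pose K := Kv * ((opnorm (negHessian E x0) + L * Kx) * Kv).
pose q s := dot (v s) (negHessian E (x s) *m v s).
have qK s : s \in `[0, T] -> - q s <= K.
  move=> s0T; rewrite (le_trans (ler_norm _))// normrN.
  apply: le_trans (normr_dot_le _ _) _.
  apply: ler_pM => //; rewrite ?l2norm_ge0 ?vK//.
  apply: le_trans (negHessian_growth hA (x s) x0 _) _.
  apply: ler_pM; rewrite ?l2norm_ge0 ?vK//.
    by rewrite addr_ge0 ?opnorm_ge0 ?mulr_ge0 ?l2norm_ge0.
  by rewrite lerD2l ler_wpM2l// xK.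
(* The defect [dot v v - 1] satisfies a linear homogeneous equation. *)
pose h s := dot (v s) (v s) - 1.
pose dh s := - 2 * gamma * q s * h s.
have hd s : s \in `]0, T[ -> is_derive s 1 h (dh s).
  rewrite in_itv/= => /ode[_ vd].
  have -> : dh s = dot (saddle_v E gamma (x s) (v s)) (v s)
      + dot (v s) (saddle_v E gamma (x s) (v s)) - 0.
    by rewrite (dotC (saddle_v _ _ _ _)) dot_saddle_v /dh /h -/(q s); ring.
  by apply: is_deriveB; exact: is_derive_dot.
have hc : {within `[0, T], continuous h}.
  move=> s; apply: cvgB; last exact: cvg_cst.
  exact: (within_continuous_dot cv cv).
(* The square of [h] has derivative [- 4 * gamma * q s * h s ^+ 2], at most
   [4 * gamma * K * h s ^+ 2]. Since it starts at 0, Gronwall forces it to stay there. *)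
have := @gronwall R (fun s => h s * h s) (fun s => h s *: dh s + h s *: dh s)
  (4 * gamma * K) T.
move=> /(_ _ _ _ t) hh t0T.
have : h t * h t <= 0.
  rewrite -(mul0r (expR (4 * gamma * K * t))).
  have -> : 0 = h 0 * h 0 by rewrite /h v00 -sqr_l2norm v0_unit; ring.
  apply: hh => // [s|s /hd sd|s s0T].
  - by apply: cvgM; exact: hc.
  - exact: is_deriveM.
  have s0T' : s \in `[0, T] by move: s0T; apply: subset_itv_oo_cc.
  have := ler_wpM2l (mulr_ge0 gamma_ge0 (sqr_ge0 (h s))) (qK s s0T').
  by rewrite /dh /GRing.scale/=; lra.
have -> : h t * h t = h t ^+ 2 by rewrite expr2.
rewrite le_eqVlt ltNge sqr_ge0 orbF sqrf_eq0 subr_eq0.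
rewrite -sqr_l2norm sqrp_eq1 ?l2norm_ge0//.
by move/eqP.
Qed.

(** For unit [v] the reflection preserves the length of the force, so its linear growth allows
    Gronwall for [1 + dot (x s) (x s)]. The bound involves only the data, which keeps the final
    constant independent of the solution. *)
Lemma solution_bounded t : t \in `[0, T] ->
  l2norm (x t) <= (1 + l2norm x0 ^+ 2) * expR (3 * (beta * L) * T).
Proof.
case: sol => x00 _ cx _ ode t0T.
have bL : 0 <= beta * L by rewrite mulr_ge0.
pose phi s := 1 + dot (x s) (x s).
have := @gronwall R phi (fun s => 0 +
  (dot (saddle_x E beta (x s) (v s)) (x s) +
   dot (x s) (saddle_x E beta (x s) (v s)))) (3 * (beta * L)) T.
move=> /(_ _ _ _ t t0T) phi_le.
have xphi : l2norm (x t) <= phi t.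
  rewrite /phi -sqr_l2norm; have := sqr_ge0 (l2norm (x t) - 1).
  by have := sqr_ge0 (l2norm (x t)); lra.
apply: le_trans xphi _; apply: le_trans (phi_le _ _ _) _.
- move=> s; apply: cvgD; first exact: cvg_cst.
  exact: (within_continuous_dot cx cx).
- move=> s; rewrite in_itv/= => /ode[xd _].
  by apply: is_deriveD; exact: is_derive_dot.
- move=> s s0T; have vs1 : l2norm (v s) = 1.
    by apply: solution_unit; move: s0T; apply: subset_itv_oo_cc.
  rewrite (dotC (saddle_x _ _ _ _)) /phi -(sqr_l2norm (x s)).
  have := dot_le (x s) (saddle_x E beta (x s) (v s)).
  have := ler_wpM2l (l2norm_ge0 (x s)) (l2norm_saddle_x hA beta_ge0 (x s) vs1).
  (* With [a = l2norm (x s)], this yields the constant 3: [2 * a <= 1 + a ^+ 2] implies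
     [2 * a * (1 + a) <= 3 * (1 + a ^+ 2)]. *)
  have := mulr_ge0 bL (sqr_ge0 (l2norm (x s) - 1)).
  move: (dot _ (saddle_x _ _ _ _)) (l2norm (saddle_x _ _ _ _)) (l2norm (x s)).
  by move=> d S a; lra.
rewrite /phi x00 sqr_l2norm; apply: ler_wpM2l.
  by rewrite addr_ge0// dotvv_ge0.
rewrite ler_expR; apply: ler_wpM2l; rewrite ?mulr_ge0//.
by move: t0T; rewrite in_itv/= => /andP[].
Qed.

(** * Local truncation error and propagation over one step *)

Section Truncation.
Variables (B M : R).
Hypothesis xB : forall t, t \in `[0, T] -> L * (1 + l2norm (x t)) <= B.
Hypothesis xM : forall t, t \in `[0, T] ->
  forall u, l2norm (negHessian E (x t) *m u) <= M * l2norm u.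

Lemma solution_lip s t : 0 <= s -> s <= t -> t <= T ->
  l2norm (x t - x s) <= beta * B * (t - s) /\
  l2norm (v t - v s) <= gamma * M * (t - s).
Proof.
case: sol => _ _ cx cv ode s0 st tT.
have sub : `[s, t] `<=` `[0, T] by apply: subset_itv; rewrite bnd_simp.
have sub' r : r \in `]s, t[ -> 0 < r < T.
  rewrite in_itv/= => /andP[sr rt].
  by rewrite (le_lt_trans s0 sr) (lt_le_trans rt tT).
have sub'' r : r \in `]s, t[ -> r \in `[0, T].
  by move=> /sub' /andP[r0 rT]; rewrite in_itv/= !ltW.
split.
  apply: (@l2norm_mean_value _ _ x
    (fun r => saddle_x E beta (x r) (v r))) => //.
  - exact: continuous_subspaceW cx.
  - by move=> r /sub' /ode[].
  move=> r /sub'' r0T.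
  apply: le_trans (l2norm_saddle_x hA beta_ge0 _ (solution_unit r0T)) _.
  by rewrite ler_wpM2l// xB.
apply: (@l2norm_mean_value _ _ v (fun r => saddle_v E gamma (x r) (v r))) => //.
- exact: continuous_subspaceW cv.
- by move=> r /sub' /ode[].
move=> r /sub'' r0T.
exact: (l2norm_saddle_v gamma_ge0 (xM r0T) (solution_unit r0T)).
Qed.

(** Over one step the solution moves by O(h), so by the Lipschitz estimates its velocity stays
    within O(h) of the velocity at [s]; [l2norm_taylor1] contributes the second factor [h]. *)
Lemma truncation_error s h : 0 <= s -> 0 <= h -> s + h <= T ->
  l2norm (x (s + h) - (x s + h *: saddle_x E beta (x s) (v s))) <=
    beta * (L * (beta * B) + 4 * B * (gamma * M)) * h ^+ 2 /\
  l2norm (v (s + h) - (v s + h *: saddle_v E gamma (x s) (v s))) <=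
    gamma * (L * (beta * B) + 3 * M * (gamma * M)) * h ^+ 2.
Proof.
case: sol => _ _ cx cv ode s0 h0 shT.
have s0T : s \in `[0, T].
  by rewrite in_itv/= s0 (le_trans _ shT)// lerDl.
have sub : `[s, s + h] `<=` `[0, T] by apply: subset_itv; rewrite bnd_simp.
have sub' r : r \in `]s, s + h[ -> 0 < r < T.
  rewrite in_itv/= => /andP[sr rt].
  by rewrite (le_lt_trans s0 sr) (lt_le_trans rt shT).
have sub'' r : r \in `]s, s + h[ -> r \in `[0, T].
  by move=> /sub' /andP[r0 rT]; rewrite in_itv/= !ltW.
have B0 : 0 <= B.
  by apply: le_trans (xB s0T); rewrite mulr_ge0// addr_ge0// l2norm_ge0.
have M0 : 0 <= M.
  have := xM s0T (v s); rewrite (solution_unit s0T) mulr1.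
  by apply: le_trans; exact: l2norm_ge0.
have lip r : r \in `]s, s + h[ -> l2norm (x r - x s) <= beta * B * h /\
    l2norm (v r - v s) <= gamma * M * h.
  move=> rsh; have /andP[_ rT] := sub' r rsh.
  move: rsh; rewrite in_itv/= => /andP[sr rsh].
  have [xl vl] := solution_lip s0 (ltW sr) (ltW rT).
  have rh : r - s <= h by rewrite lerBlDl ltW.
  by split; [apply: le_trans xl _|apply: le_trans vl _];
     rewrite ler_wpM2l// mulr_ge0.
have hE : s + h - s = h by rewrite addrC addKr.
(* To match [l2norm_taylor1], the step length and one factor of [h ^+ 2] are written [s + h - s];
   the other factor stays in the velocity bound. *)
rewrite -[X in X *: saddle_x _ _ _ _]hE -[X in X *: saddle_v _ _ _ _]hE.
rewrite expr2 !(mulrA _ h h).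
rewrite -[X in _ <= _ * X /\ _]hE -[X in _ /\ _ <= _ * X]hE.
split.
  apply: (@l2norm_taylor1 _ _ x (fun r => saddle_x E beta (x r) (v r))) => //.
  - by rewrite lerDl.
  - exact: continuous_subspaceW cx.
  - by move=> r /sub' /ode[].
  move=> r rsh; have r0T := sub'' r rsh; have [xl vl] := lip r rsh.
  apply: le_trans (saddle_x_lip hA beta_ge0 _ _
    (solution_unit r0T) (solution_unit s0T)) _.
  rewrite -(mulrA beta); apply: ler_wpM2l => //.
  rewrite [leRHS]mulrDl -(mulrA L) -(mulrA (4 * B)).
  apply: lerD; first exact: ler_wpM2l.
  apply: ler_pM => //; rewrite ?mulr_ge0 ?addr_ge0 ?l2norm_ge0//.
  by rewrite ler_wpM2l// xB.
apply: (@l2norm_taylor1 _ _ v (fun r => saddle_v E gamma (x r) (v r))) => //.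
- by rewrite lerDl.
- exact: continuous_subspaceW cv.
- by move=> r /sub' /ode[].
move=> r rsh; have r0T := sub'' r rsh; have [xl vl] := lip r rsh.
apply: le_trans (saddle_v_lip hA gamma_ge0 _ (xM r0T)
  (solution_unit r0T) (solution_unit s0T)) _.
rewrite -(mulrA gamma); apply: ler_wpM2l => //.
rewrite [leRHS]mulrDl -(mulrA L) -(mulrA (3 * M)).
apply: lerD; first exact: ler_wpM2l.
by apply: ler_wpM2l; rewrite ?mulr_ge0.
Qed.

(** The comparison passes through the unnormalized Euler step started on the exact trajectory at
    time [s]: truncation measures its distance to the solution, the Lipschitz estimates its distance
    to the step from [(a, w)]. Normalization of the latter is removed first, by nonexpansiveness. *)
Lemma euler_step_error s h a w : 0 <= s -> 0 <= h -> s + h <= T ->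
  l2norm w = 1 ->
  let p := euler_step E beta gamma h (a, w) in
  l2norm (x (s + h) - p.1) + l2norm (v (s + h) - p.2) <=
  (1 + h * (beta * (L + 4 * B) + gamma * (L + 3 * M))) *
    (l2norm (x s - a) + l2norm (v s - w)) +
  (beta * (L * (beta * B) + 4 * B * (gamma * M)) +
   gamma * (L * (beta * B) + 3 * M * (gamma * M))) * h ^+ 2.
Proof.
move=> s0 h0 shT w1 /=.
have s0T : s \in `[0, T].
  by rewrite in_itv/= s0 (le_trans _ shT)// lerDl.
have [xh vh] := truncation_error s0 h0 shT.
set w' := w + h *: saddle_v E gamma a w.
have w'1 : 1 <= l2norm w' := l2norm_euler_v_ge1 gamma h a w1.
have vs1 := solution_unit s0T.
have shT' : s + h \in `[0, T] by rewrite in_itv/= shT addr_ge0.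
have sx := ler_wpM2l h0 (saddle_x_lip hA beta_ge0 (x s) a vs1 w1).
have sv := ler_wpM2l h0 (saddle_v_lip hA gamma_ge0 a (xM s0T) vs1 w1).
have B0 : 0 <= B.
  by apply: le_trans (xB s0T); rewrite mulr_ge0// addr_ge0// l2norm_ge0.
have M0 : 0 <= M.
  have := xM s0T (v s); rewrite vs1 mulr1.
  by apply: le_trans; exact: l2norm_ge0.
have stab p q (y z : 'cV[R]_N) :
    l2norm (y + h *: p - (z + h *: q)) <= l2norm (y - z) + h * l2norm (p - q).
  rewrite opprD addrACA -scalerBr (le_trans (l2normD _ _))// lerD2l l2normZ.
  by rewrite ger0_norm.
have ex : l2norm (x (s + h) - (a + h *: saddle_x E beta a w)) <=
    beta * (L * (beta * B) + 4 * B * (gamma * M)) * h ^+ 2 +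
    (l2norm (x s - a) +
     h * (beta * (L * l2norm (x s - a) + 4 * B * l2norm (v s - w)))).
  apply: le_trans (l2normBD _ _ _) (lerD xh _).
  apply: le_trans (stab _ _ _ _) _; rewrite lerD2l; apply: le_trans sx _.
  apply: ler_wpM2l => //; apply: ler_wpM2l => //; rewrite lerD2l.
  by apply: ler_wpM2r; [exact: l2norm_ge0|apply: ler_wpM2l => //; exact: xB].
have ev : l2norm (v (s + h) - (l2norm w')^-1 *: w') <=
    gamma * (L * (beta * B) + 3 * M * (gamma * M)) * h ^+ 2 +
    (l2norm (v s - w) +
     h * (gamma * (L * l2norm (x s - a) + 3 * M * l2norm (v s - w)))).
  apply: le_trans (l2norm_normalize (solution_unit shT') w'1) _.
  apply: le_trans (l2normBD _ _ _) (lerD vh _).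
  by apply: le_trans (stab _ _ _ _) _; rewrite lerD2l.
apply: le_trans (lerD ex ev) _.
have := l2norm_ge0 (x s - a); have := l2norm_ge0 (v s - w).
move: (l2norm (x s - a)) (l2norm (v s - w)) => X V V0 X0.
rewrite -subr_ge0.
set K1 := beta * (L * (beta * B) + _); set K2 := gamma * (L * (beta * B) + _).
(* The common amplification factor exceeds what the two estimates give; the surplus is a sum of
   nonnegative terms. *)
have -> : (1 + h * (beta * (L + 4 * B) + gamma * (L + 3 * M))) * (X + V)
    + (K1 + K2) * h ^+ 2 - (K1 * h ^+ 2
      + (X + h * (beta * (L * X + 4 * B * V))) + (K2 * h ^+ 2
      + (V + h * (gamma * (L * X + 3 * M * V))))) =
  h * beta * (L * V + 4 * B * X) + h * gamma * (L * V + 3 * M * X) by ring.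
by rewrite addr_ge0 ?mulr_ge0// addr_ge0 ?mulr_ge0.
Qed.

End Truncation.
End Solution.

(** * Global error estimate *)

Lemma euler_unit (R : realType) (N : nat) (E : 'cV[R]_N -> R)
    (beta gamma h : R) (x0 v0 : 'cV[R]_N) n :
  l2norm v0 = 1 -> l2norm (euler E beta gamma h x0 v0 n).2 = 1.
Proof.
move=> v01; elim: n => [//|n]; rewrite /euler iterS.
case: (iter _ _ _) => a w /= w1; apply: l2norm_normalized.
exact: l2norm_euler_v_ge1.
Qed.

Theorem theorem3p4 (R : realType) (N : nat) (E : 'cV[R]_N -> R)
    (beta gamma T L : R) (x0 v0 : 'cV[R]_N)
    (E_diff : twice_differentiable E)
    (beta_gt0 : 0 < beta) (gamma_gt0 : 0 < gamma) (T_gt0 : 0 < T)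
    (L_gt0 : 0 < L) (hA : assumptionA E L) (v0_unit : l2norm v0 = 1) :
  exists Q : R, 0 < Q /\
    forall x v : R -> 'cV[R]_N,
      saddle_solution E beta gamma T x0 v0 x v ->
      forall NT : nat, (0 < NT)%N ->
      let tau := T / NT%:R in
      forall n : nat, (1 <= n <= NT)%N ->
        let t_n := n%:R * tau in
        let x_n := (euler E beta gamma tau x0 v0 n).1 in
        let v_n := (euler E beta gamma tau x0 v0 n).2 in
        l2norm (x t_n - x_n) + l2norm (v t_n - v_n) <= Q * tau.
Proof.
have [b0 g0] := (ltW beta_gt0, ltW gamma_gt0).
have [T0 L0] := (ltW T_gt0, ltW L_gt0).
(* [C] bounds the position on the whole interval, and [B] and [M] are the resulting bounds for the
   force and the Hessian. All constants are fixed before the solution and the step size are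
   introduced. *)
pose C := (1 + l2norm x0 ^+ 2) * expR (3 * (beta * L) * T).
pose B := L * (1 + C).
pose M := opnorm (negHessian E x0) + L * (C + l2norm x0).
(* [K] collects the truncation constants of both components, and [Lam] is the growth rate of the
   error in one step. *)
pose K := beta * (L * (beta * B) + 4 * B * (gamma * M)) +
          gamma * (L * (beta * B) + 3 * M * (gamma * M)).
pose Lam := beta * (L + 4 * B) + gamma * (L + 3 * M).
have C0 : 0 <= C by rewrite mulr_ge0 ?expR_ge0// addr_ge0// sqr_ge0.
have B0 : 0 <= B by rewrite mulr_ge0// addr_ge0.
have M0 : 0 <= M.
  by rewrite addr_ge0 ?opnorm_ge0 ?mulr_ge0 ?addr_ge0 ?l2norm_ge0.
have K0 : 0 <= K by do 5?[apply: addr_ge0 | apply: mulr_ge0 => //].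
have Lam0 : 0 <= Lam by do 5?[apply: addr_ge0 => // | apply: mulr_ge0 => //].
(* The added 1 makes the constant strictly positive, since only [0 <= K] is established. *)
exists (T * K * expR (T * Lam) + 1); split.
  by rewrite ltr_wpDl// !mulr_ge0// expR_ge0.
move=> x v sol NT NT0 tau n /andP[_ nNT] /=.
have NT0' : 0 < NT%:R :> R by rewrite ltr0n.
have tau0 : 0 <= tau by rewrite divr_ge0// ltW.
have ntau k : (k <= NT)%N -> k%:R * tau <= T.
  by move=> kN; rewrite mulrCA ler_piMr// ler_pdivrMr// mul1r ler_nat.
have xC := solution_bounded b0 g0 T0 L0 hA v0_unit sol.
have xB t : t \in `[0, T] -> L * (1 + l2norm (x t)) <= B.
  by move=> tT; rewrite ler_wpM2l// lerD2l xC.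
have xM t : t \in `[0, T] ->
    forall u, l2norm (negHessian E (x t) *m u) <= M * l2norm u.
  move=> tT u; apply: le_trans (negHessian_growth hA (x t) x0 u) _.
  apply: ler_wpM2r; first exact: l2norm_ge0.
  rewrite lerD2l; apply: ler_wpM2l => //.
  by apply: le_trans (l2normD _ _) _; rewrite l2normN lerD2r xC.
pose p k := euler E beta gamma tau x0 v0 k.
pose e k := l2norm (x (k%:R * tau) - (p k).1) +
  l2norm (v (k%:R * tau) - (p k).2).
have e0 : e 0 <= 0.
  by case: sol => x00 v00 _ _ _; rewrite /e mul0r x00 v00 !subrr l2norm0 addr0.
have eS k : (k < NT)%N -> e k.+1 <= (1 + tau * Lam) * e k + K * tau ^+ 2.
  move=> kN; rewrite /e -natr1 mulrDl mul1r.
  have := euler_unit E beta gamma tau x0 k v0_unit.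
  rewrite /p [euler _ _ _ _ _ _ k.+1]iterS -/(euler E beta gamma tau x0 v0 k).
  case: (euler _ _ _ _ _ _ k) => a w /= w1.
  apply: (euler_step_error b0 g0 T0 L0 hA v0_unit sol xB xM) => //.
    by rewrite mulr_ge0.
  by have := ntau _ kN; rewrite -natr1 mulrDl mul1r.
have := discrete_gronwall (mulr_ge0 tau0 Lam0) (mulr_ge0 K0 (sqr_ge0 tau))
  e0 eS nNT.
rewrite -/(p n) -/(e n) => /le_trans; apply.
(* Of the two factors [tau], one joins [n%:R] to form a time at most [T]; the other is the order of
   convergence. *)
have -> : n%:R * (K * tau ^+ 2) * expR (n%:R * (tau * Lam)) =
    (n%:R * tau) * K * expR (n%:R * tau * Lam) * tau.
  by rewrite (mulrA n%:R tau Lam); ring.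
apply: ler_wpM2r => //; rewrite ler_wpDr//.
apply: ler_pM; rewrite ?expR_ge0 ?mulr_ge0//.
  by rewrite ler_wpM2r// ntau.
by rewrite ler_expR ler_wpM2r// ntau.
Qed.
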